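(* Let $m\ge 7$ be an odd integer and let $F$ be a bipartite directed $2$-factor of order $2m$. If there exists an $F$-factorization of $W_{2m}^*$, then there exists an $F$-factorization of $K_{2m}^*$.
   Context: A directed $2$-factor $[m_1,\ldots,m_t]$ of order $m_1+\cdots+m_t$ is a digraph consisting of vertex-disjoint directed cycles of lengths $m_1,\ldots,m_t$ (each $m_i\ge2$; a directed $2$-cycle on $\{u,v\}$ consists of arcs $uv$ and $vu$); it is bipartite if all $m_i$ are even. $W_{2m}$ is the lexicographic product $\mathrm{Circ}(m,\{\pm1,\pm2\})[K_2]$: vertex set $\{x_i,y_i : i\in\mathbb{Z}_m\}$, where $x_i$ is adjacent to $y_i$, and each of $x_i,y_i$ is adjacent to each of $x_j,y_j$ whenever $i-j\in\{\pm1,\pm2\}$ in $\mathbb{Z}_m$. For a graph $G$, $G^*$ is the digraph obtained by replacing each edge $\{u,v\}$ by the arcs $uv$ and $vu$; $K_{2m}^*$ is the complete symmetric digraph on $2m$ vertices. An $F$-factorization of a digraph $D$ is a partition of the arc set of $D$ into spanning subdigraphs each isomorphic to $F$. *)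

(* Defs.v *)
From mathcomp Require Import all_boot all_order all_algebra.

Set Implicit Arguments.
Unset Strict Implicit.
Unset Printing Implicit Defensive.

Import GRing.Theory.

(* A digraph with vertex set V, given by its set of arcs: every vertex of V
   is a vertex of the digraph, so a spanning subdigraph of D : digraph V is
   an arc set A : digraph V with A \subset D. *)
Definition digraph (V : finType) := {set V * V}.

Definition digraph_iso (U V : finType) (F : digraph U) (H : digraph V) : Prop :=
  exists2 f : U -> V, bijective f &
    forall u v, ((u, v) \in F) = ((f u, f v) \in H).

Definition has_factorization (U V : finType) (F : digraph U) (D : digraph V)
    : Prop :=
  exists2 P : {set digraph V}, partition P D &
    forall H, H \in P -> digraph_iso F H.

Definition two_factor_vertex (ms : seq nat) : finType :=
  {i : 'I_(size ms) & 'I_(nth 0 ms i)}.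

Definition cycle_index (ms : seq nat) (u : two_factor_vertex ms) : nat := tag u.
Definition cycle_pos (ms : seq nat) (u : two_factor_vertex ms) : nat := tagged u.

(* The digraph [m_1, ..., m_t]: vertex (i, a) has its only out-arc to
   (i, a + 1 mod m_i). *)
Definition two_factor (ms : seq nat) : digraph (two_factor_vertex ms) :=
  [set e | (cycle_index e.1 == cycle_index e.2) &&
    (cycle_pos e.2 == (cycle_pos e.1).+1 %% nth 0 ms (cycle_index e.1))].

(* Undirected graphs are symmetric irreflexive relations; G^* is then simply
   the set of ordered pairs of adjacent vertices. *)
Definition symdigraph (V : finType) (G : rel V) : digraph V :=
  [set e | G e.1 e.2].

Definition complete (V : finType) : rel V := fun u v => u != v.

(* The circulant graph on Z_m with connection set S = -S; 'Z_m is the ring of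
   integers modulo m only for m > 1. *)
Definition Circ (m : nat) (S : {set 'Z_m}) : rel 'Z_m :=
  fun i j => (i - j)%R \in S.

(* G[H]: a copy of H in place of each vertex of G. *)
Definition lexprod (V U : finType) (G : rel V) (H : rel U) : rel (V * U) :=
  fun p q => G p.1 q.1 || (p.1 == q.1) && H p.2 q.2.

(* x_i is (i, false) and y_i is (i, true). *)
Definition W (m : nat) : rel ('Z_m * bool) :=
  lexprod (@Circ m [set 1%R; (-1)%R; 2%R; (-2)%R]) (@complete bool).

Lemma W_sym m : symmetric (@W m).
Proof.
move=> [i a] [j b]; rewrite /W /lexprod /Circ /complete /= !inE.
rewrite (eq_sym j) (eq_sym b) -(opprB i j) !eqr_opp !(eqr_oppLR (i - j)).
by congr (_ || _); rewrite -!orbA orbCA; do 2 congr (_ || _); rewrite orbC.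
Qed.

Lemma W_irr m : 2 < m -> irreflexive (@W m).
Proof.
move=> m_gt2 [i a]; rewrite /W /lexprod /Circ /complete /= !inE.
rewrite subrr !eqxx /= !(eq_sym 0%R) !oppr_eq0.
by case: m m_gt2 i => [|[|[|m]]].
Qed.

(* Main.v *)
Require Import Defs.
From mathcomp Require Import all_boot all_order all_algebra.
From mathcomp Require Import zify ring.

Set Implicit Arguments.
Unset Strict Implicit.
Unset Printing Implicit Defensive.

Import GRing.Theory.

(** K_2m^* is the arc-disjoint union of W^* and G[2K_1]^*, where G is the
    circulant on Z_m with distances 3, ..., (m-1)/2.

    If C is a Hamiltonian cycle of G, then C[2K_1]^* splits into four copies of
    F: thread the cycles of F one after the other along C, each going forward
    through consecutive columns and coming back through the other vertices. A
    copy is determined by the choice of the forward vertex in each column; let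
    f range over F_2^2 and take for this choice one of the three nonzero linear
    functionals of f, distinct ones in consecutive columns. Every arc then
    occurs for exactly one f.

    It remains to decompose G into Hamiltonian cycles. The distances d, d+1 are
    paired; if one is left over it is (m-1)/2, which is coprime to m. For a
    pair {a, b} with gcd(a, m) > gcd(b, m) coprime, start from the 2-factor of
    the a-edges (g = gcd(a, m) rows) and that of the b-edges (h = gcd(b, m)
    columns) and exchange opposite sides of g - 1 parallelograms
    x, x+a, x+b, x+a+b, one between any two consecutive rows. The
    parallelograms are placed so that both 2-factors become connected. *)

(** * Factorizations as indexed families *)

Definition factor_family (U V : finType) (F : digraph U) (D : digraph V) : Prop :=
  exists (I : finType) (H : I -> digraph V),
    [/\ forall i, digraph_iso F (H i),
        forall i e, e \in H i -> e \in D,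
        forall e, e \in D -> exists i, e \in H i &
        forall i j e, e \in H i -> e \in H j -> i = j].

(** Indexed families are easier to add and to transport than sets of blocks. [F != set0] keeps every
    member nonempty, as [partition] demands. *)
Lemma factor_familyP (U V : finType) (F : digraph U) (D : digraph V) :
  F != set0 -> has_factorization F D <-> factor_family F D.
Proof.
move=> F0; split.
  case=> P /and3P[/eqP covP trivP _] isoP.
  exists {H : digraph V | H \in P}, (fun H => val H); split.
  - by move=> [H HP]; exact: isoP.
  - by move=> [H HP] e /= eH; rewrite -covP; apply/bigcupP; exists H.
  - move=> e; rewrite -covP => /bigcupP[H HP eH].
    by exists (Sub H HP).
  - move=> [H HP] [H' HP'] e /= eH eH'; apply/val_inj => /=.
    by rewrite -(def_pblock trivP HP eH) (def_pblock trivP HP' eH').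
case=> I [H [isoH subH covH uniqH]].
have H0 i : H i != set0.
  case/set0Pn: F0 => -[u v] uvF; case: (isoH i) => f _ fE.
  by apply/set0Pn; exists (f u, f v); rewrite -fE.
exists [set H i | i in I]; last by move=> _ /imsetP[i _ ->].
apply/and3P; split.
- apply/eqP/setP=> e; apply/bigcupP/idP.
    by case=> _ /imsetP[i _ ->]; apply: subH.
  by case/covH=> i ei; exists (H i) => //; apply: imset_f.
- apply/trivIsetP=> _ _ /imsetP[i _ ->] /imsetP[j _ ->] neq.
  rewrite -setI_eq0; apply/eqP/setP=> e; rewrite !inE; apply/negP=> /andP[ei ej].
  by case/negP: neq; apply/eqP; rewrite (uniqH _ _ _ ei ej).
- by apply/imsetP=> -[i _ Hi]; move: (H0 i); rewrite -Hi eqxx.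
Qed.

Lemma factor_familyU (U V : finType) (F : digraph U) (D1 D2 : digraph V) :
  [disjoint D1 & D2] -> factor_family F D1 -> factor_family F D2 ->
  factor_family F (D1 :|: D2).
Proof.
move=> disD [I1 [H1 [iso1 sub1 cov1 uni1]]] [I2 [H2 [iso2 sub2 cov2 uni2]]].
pose H (i : I1 + I2) := match i with inl i => H1 i | inr i => H2 i end.
have D12 e : e \in D1 -> e \in D2 -> False.
  by move=> e1 e2; have := disjointFr disD e1; rewrite e2.
exists (I1 + I2)%type, H; split.
- by case.
- by case=> i e /= ei; rewrite inE ?(sub1 _ _ ei) ?(sub2 _ _ ei) ?orbT.
- move=> e /setUP[/cov1|/cov2] [i ei]; first by exists (inl i).
  by exists (inr i).
- case=> i [] j e /= ei ej.
  + by rewrite (uni1 _ _ _ ei ej).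
  + by case: (D12 e); [apply: sub1 ei | apply: sub2 ej].
  + by case: (D12 e); [apply: sub1 ej | apply: sub2 ei].
  + by rewrite (uni2 _ _ _ ei ej).
Qed.

Lemma factor_family_transport (U V V' : finType) (F : digraph U)
    (D : digraph V) (D' : digraph V') (f : V' -> V) :
  bijective f -> (forall u v, ((u, v) \in D') = ((f u, f v) \in D)) ->
  factor_family F D -> factor_family F D'.
Proof.
move=> bijf fE [I [H [isoH subH covH uniH]]].
exists I, (fun i => [set e | (f e.1, f e.2) \in H i]); split.
- move=> i; have [phi bij_phi phiE] := isoH i.
  case: (bijf) => f' fK f'K; exists (f' \o phi).
    by apply: bij_comp => //; exists f.
  by move=> u v; rewrite inE /= !f'K.
- by move=> i [u v]; rewrite inE /= fE; apply: subH.
- move=> [u v]; rewrite fE => /covH[i ei]; exists i.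
  by rewrite inE.
- by move=> i j [u v]; rewrite !inE; apply: uniH.
Qed.

(** * Hamiltonian decompositions of graphs on ['Z_m] *)

Definition cycle_edge (m : nat) (V : Type) (p : 'Z_m -> V) (x y : V) : Prop :=
  exists i, (x = p i /\ y = p (i + 1)%R) \/ (y = p i /\ x = p (i + 1)%R).

(** Each cycle is parametrized by ['Z_m], so that composing with [p k] sends the columns of F to its
    vertices. *)
Definition ham_decomposition (m : nat) (G : rel 'Z_m) : Prop :=
  exists (K : finType) (p : K -> 'Z_m -> 'Z_m),
    [/\ forall k, injective (p k),
        forall k x y, cycle_edge (p k) x y -> G x y,
        forall x y, G x y -> exists k, cycle_edge (p k) x y &
        forall k l x y, cycle_edge (p k) x y -> cycle_edge (p l) x y -> k = l].

Lemma ham_decomposition_ext m (G G' : rel 'Z_m) :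
  G =2 G' -> ham_decomposition G -> ham_decomposition G'.
Proof.
move=> E [K [p [inj sub cov uni]]]; exists K, p; split=> //.
- by move=> k x y /sub; rewrite E.
- by move=> x y; rewrite -E; apply: cov.
Qed.

Lemma ham_decompositionU m (G G' : rel 'Z_m) :
  (forall x y, G x y -> ~~ G' x y) ->
  ham_decomposition G -> ham_decomposition G' ->
  ham_decomposition (fun x y => G x y || G' x y).
Proof.
move=> dis [K [p [inj sub cov uni]]] [K' [p' [inj' sub' cov' uni']]].
exists (K + K')%type, (fun k => match k with inl k => p k | inr k => p' k end).
split.
- by case.
- by case=> k x y /= => [/sub ->|/sub' ->]; rewrite ?orbT.
- by move=> x y /orP[/cov|/cov'] [k ek]; [exists (inl k) | exists (inr k)].
- case=> k [] l x y /= ek el.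
  + by rewrite (uni _ _ _ _ ek el).
  + by have := dis _ _ (sub _ _ _ ek); rewrite (sub' _ _ _ el).
  + by have := dis _ _ (sub _ _ _ el); rewrite (sub' _ _ _ ek).
  + by rewrite (uni' _ _ _ _ ek el).
Qed.

(** * Threading F along a Hamiltonian cycle *)

Lemma surj_card_bij (T T' : finType) (f : T -> T') :
  #|T| = #|T'| -> (forall y, exists x, f x = y) -> bijective f.
Proof.
move=> cardE surj; apply: inj_card_bij; last by rewrite cardE.
have: #|image f T| == #|T|.
  rewrite cardE; apply/eqP/eq_card=> y; rewrite !inE.
  by have [x <-] := surj y; apply/imageP; exists x.
by move/image_injP=> inj x y; apply: inj.
Qed.

Lemma card_Z (m : nat) : 1 < m -> #|'Z_m| = m.
Proof. by move=> m1; rewrite card_ord Zp_cast. Qed.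

Lemma eq_Zp_nat (m x y : nat) : 1 < m ->
  ((x%:R == y%:R :> 'Z_m)%R) = (x == y %[mod m]).
Proof. by move=> m1; rewrite -val_eqE /= !val_Zp_nat. Qed.

Lemma card_two_factor_vertex ms : #|two_factor_vertex ms| = sumn ms.
Proof.
rewrite card_tagged !sumnE big_map big_enum /= [RHS](big_nth 0) big_mkord.
by apply: eq_bigr => i _; rewrite card_ord.
Qed.

(* [m_1, ..., m_t] winds once around Z_m: a cycle of length 2k runs forward
   through k + 1 consecutive columns and then back, and consecutive cycles
   share their extreme column. [dir u] tells whether the arc leaving [u] goes
   back. *)
Section Coordinates.

Variables (m : nat) (ms : seq nat).
Hypotheses (m_gt1 : 1 < m) (ms_ge2 : all (fun k => 2 <= k) ms).
Hypotheses (ms_even : all (fun k => ~~ odd k) ms) (ms_sum : sumn ms = 2 * m).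

Let U := two_factor_vertex ms.
Let len (u : U) := nth 0 ms (tag u).
Definition start i := (sumn (take i ms))./2.
(** In a cycle of length l, position a lies min(a, l - a) columns after the first one: the tent
    rises for l/2 steps and then falls back. *)
Definition column (u : U) : 'Z_m :=
  (start (tag u) + minn (cycle_pos u) (len u - cycle_pos u))%:R%R.
Definition backward (u : U) : bool := (len u)./2 <= cycle_pos u.

Lemma len_even i : i < size ms -> ~~ odd (nth 0 ms i).
Proof. by move=> ilt; apply: (all_nthP 0 ms_even). Qed.

Lemma len_ge2 i : i < size ms -> 2 <= nth 0 ms i.
Proof. by move=> ilt; apply: (all_nthP 0 ms_ge2). Qed.

Lemma sumn_take_even i : ~~ odd (sumn (take i ms)).
Proof.
have: all (fun k => ~~ odd k) (take i ms).
  by move: ms_even; rewrite -{1}(cat_take_drop i ms) all_cat => /andP[].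
elim: (take i ms) => //= k s IHs /andP[ek es].
by rewrite oddD negb_add (negbTE ek) (negbTE (IHs es)).
Qed.

Lemma startS i : i < size ms -> start i.+1 = start i + (nth 0 ms i)./2.
Proof.
move=> ilt; rewrite /start (take_nth 0 ilt) sumn_rcons halfD.
by rewrite (negbTE (sumn_take_even i)).
Qed.

Lemma start_block c : c < m ->
  exists2 i, i < size ms & start i <= c < start i.+1.
Proof.
move=> clt; have size_start : start (size ms) = m.
  by rewrite /start take_size ms_sum mul2n doubleK.
have ex : exists i, c < start i by exists (size ms); rewrite size_start.
case: (ex_minnP ex) => -[|i] ci min_i; first by move: ci; rewrite /start take0.
have ilt : i < size ms by apply: min_i; rewrite size_start.
exists i => //; rewrite ci andbT leqNgt.
by apply/negP=> /min_i; rewrite ltnn.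
Qed.

(** Cycle i has its forward vertices in columns [start i], ..., [start i.+1 - 1] and its backward
    ones in [start i + 1], ..., [start i.+1]. Over all i, either family of intervals covers ['Z_m]
    once. By cardinality surjectivity is enough. *)
Lemma column_backward_bij : bijective (fun u : U => (column u, backward u)).
Proof.
apply: surj_card_bij.
  by rewrite card_two_factor_vertex card_prod card_bool card_Z // ms_sum mulnC.
case=> c d; have clt : (c : nat) < m by rewrite -[m in _ < m]Zp_cast // ltn_ord.
have cE : c = (c : nat)%:R%R by rewrite natr_Zp.
case: d.
  (* Backward vertices are shifted by one column, so the relevant block is that of c - 1; column 0
     is reached as m, at the end of the last cycle. *)
  pose c1 := if (c : nat) == 0 then m.-1 else (c : nat).-1.
  have c1lt : c1 < m by rewrite /c1; case: ifP; lia.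
  have [i ilt /andP[ic ci]] := start_block c1lt.
  move: (startS ilt) (len_even ilt) => sS le.
  have alt : nth 0 ms i - (c1.+1 - start i) < nth 0 ms i.
    by move: (len_ge2 ilt); lia.
  exists (Tagged (fun i : 'I_(size ms) => 'I_(nth 0 ms i))
    (Ordinal alt : 'I_(nth 0 ms (Ordinal ilt)))).
  rewrite /column /backward /cycle_pos /len /=; congr (_, _); last by lia.
  rewrite cE; apply/eqP; rewrite eq_Zp_nat //.
  have -> : start i + minn (nth 0 ms i - (c1.+1 - start i))
    (nth 0 ms i - (nth 0 ms i - (c1.+1 - start i))) = c1.+1 by lia.
  rewrite /c1; case: ifP => [/eqP c0|c0]; last by rewrite prednK // lt0n c0.
  by rewrite c0 prednK ?modnn ?mod0n // ltnW.
have [i ilt /andP[ic ci]] := start_block clt.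
move: (startS ilt) (len_even ilt) => sS le.
have alt : c - start i < nth 0 ms i by move: (len_ge2 ilt); lia.
exists (Tagged (fun i : 'I_(size ms) => 'I_(nth 0 ms i))
  (Ordinal alt : 'I_(nth 0 ms (Ordinal ilt)))).
rewrite /column /backward /cycle_pos /len /=; congr (_, _); last by lia.
rewrite [RHS]cE; congr (_%:R)%R; lia.
Qed.

Lemma column_succ u v : (u, v) \in two_factor ms ->
  column v = if backward u then (column u - 1)%R else (column u + 1)%R.
Proof.
rewrite inE /cycle_index /cycle_pos /= => /andP[/eqP iE /eqP aE].
have ilt := ltn_ord (tag u).
have := len_even ilt; have := len_ge2 ilt; have := ltn_ord (tagged u).
rewrite /column /backward /len /cycle_pos aE -iE.
move: (nth 0 ms (tag u)) (start _) (tagged u : nat) => l s a al l2 el.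
case: ifP => la.
  apply/eqP; rewrite eq_sym subr_eq; apply/eqP; rewrite -[1%R]/(1%:R)%R -natrD.
  (* At position l - 1, one column after the first, the successor is position 0. *)
  congr (_%:R)%R; case: (ltnP a.+1 l) => al1; first by rewrite modn_small; lia.
  by rewrite (_ : a.+1 = l) ?modnn; lia.
rewrite -[1%R]/(1%:R)%R -natrD; congr (_%:R)%R; rewrite modn_small; lia.
Qed.

Lemma two_factor_succ u : exists v, (u, v) \in two_factor ms.
Proof.
have alt : (cycle_pos u).+1 %% nth 0 ms (tag u) < nth 0 ms (tag u).
  by rewrite ltn_mod; move: (len_ge2 (ltn_ord (tag u))); lia.
exists (Tagged (fun i : 'I_(size ms) => 'I_(nth 0 ms i)) (Ordinal alt)).
by rewrite inE /cycle_index /cycle_pos /= !eqxx.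
Qed.

End Coordinates.

Lemma two_factor_succ_inj ms u v w :
  (u, v) \in two_factor ms -> (u, w) \in two_factor ms -> v = w.
Proof.
rewrite !inE /cycle_index /cycle_pos /=.
move=> /andP[/eqP iv /eqP av] /andP[/eqP iw /eqP aw].
move: v w iv av iw aw => [i a] [j b] /= iv av iw aw.
have ij : i = j by apply: val_inj; rewrite /= -iv -iw.
by move: b aw; rewrite -ij => b aw; congr existT; apply: val_inj; rewrite /= av aw.
Qed.

Lemma val_Zp_add1 (m : nat) (c : 'Z_m) : 1 < m ->
  (c + 1)%R = (if c == m.-1 :> nat then 0 else c.+1) :> nat.
Proof.
move=> m1; have clt : (c : nat) < m by rewrite -[m in _ < m]Zp_cast // ltn_ord.
rewrite -[in LHS](natr_Zp c) -[1%R]/(1%:R)%R -natrD val_Zp_nat // addn1.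
by case: eqP => cE; [rewrite cE prednK ?modnn //; lia | rewrite modn_small //; lia].
Qed.

(* The three nonzero functionals of [f], distinct at consecutive columns: [c] and
   [c + 1] have distinct parities except around [m - 1], as [m] is odd. *)
Definition label (m : nat) (c : 'Z_m) (f : bool * bool) : bool :=
  if c == m.-1 :> nat then f.1 (+) f.2 else if odd c then f.2 else f.1.

(** Two distinct nonzero functionals on F_2^2 are independent, so their values can be prescribed
    together. *)
Lemma label_surj (m : nat) (c : 'Z_m) x y : 2 < m -> odd m ->
  exists f, label c f = x /\ label (c + 1)%R f = y.
Proof.
move=> m2 m_odd; have m1 : 1 < m by exact: ltnW.
have clt : (c : nat) < m by rewrite -[m in _ < m]Zp_cast // ltn_ord.
rewrite /label val_Zp_add1 //.
have [cE|cE] := eqVneq (c : nat) m.-1.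
  rewrite (_ : 0 == m.-1 = false) /=; last by lia.
  by exists (y, x (+) y); case: x y => [] [].
have [cE'|cE'] := eqVneq c.+1 m.-1.
  rewrite (_ : odd c); last by lia.
  by exists (x (+) y, x); case: x y => [] [].
rewrite /=; case: (odd c) => /=; first by exists (y, x).
by exists (x, y).
Qed.

Lemma label_inj (m : nat) (c : 'Z_m) f g : 2 < m -> odd m ->
  label c f = label c g -> label (c + 1)%R f = label (c + 1)%R g -> f = g.
Proof.
move=> m2 m_odd fg fg1.
have /surj_card_bij/(_ _)/bij_inj inj : #|{: bool * bool}| = #|{: bool * bool}|.
  by [].
apply: (inj (fun f => (label c f, label (c + 1)%R f))) => [[x y]|].
  by have [h [hx hy]] := label_surj c x y m2 m_odd; exists h; rewrite hx hy.
by rewrite fg fg1.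
Qed.

Lemma Zp_succ_neq_pred (m : nat) (c : 'Z_m) : 2 < m -> (c + 1 <> c - 1)%R.
Proof.
move=> m2 /eqP; rewrite -subr_eq0 (_ : c + 1 - (c - 1) = 1 + 1)%R; last by ring.
rewrite -[1%R]/(1%:R)%R -natrD -[0%R]/(0%:R)%R eq_Zp_nat; last by lia.
by rewrite mod0n modn_small.
Qed.

(** An arc from (x, a) to (y, b) lies over an edge of exactly one cycle k. The direction in which it
    runs along that cycle decides whether its tail is the forward or the backward vertex of the
    column, and hence which arc of F it comes from. The bits a, b then prescribe the labels of two
    consecutive columns, which leaves exactly one f. *)
Lemma factor_family_lexprod (m : nat) ms (G : rel 'Z_m) :
  2 < m -> odd m -> all (fun k => 2 <= k) ms -> all (fun k => ~~ odd k) ms ->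
  sumn ms = 2 * m -> ham_decomposition G ->
  factor_family (two_factor ms) [set e : ('Z_m * bool) * ('Z_m * bool) | G e.1.1 e.2.1].
Proof.
move=> m2 m_odd ge2 ev sumE [K [p [p_inj sub cov uni]]].
have m1 : 1 < m by exact: ltnW.
pose col (u : two_factor_vertex ms) : 'Z_m := column m u.
have bij := column_backward_bij m1 ge2 ev sumE.
have succE u v : (u, v) \in two_factor ms -> col v = _ := column_succ m1 ge2 ev sumE (v:=v) (u:=u).
have colP c d : exists2 u, col u = c & backward u = d.
  by case: bij => h _ hK; exists (h (c, d)); case: (hK (c, d)).
(* The backward vertex of a column gets the complement of the bit of the forward one. *)
pose phi (i : K * (bool * bool)) u :=
  (p i.1 (col u), label (col u) i.2 (+) backward u).
have phi_inj i : injective (phi i).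
  move=> u v [/p_inj cE]; rewrite cE => /addbI bE.
  by apply: (bij_inj bij); rewrite -/(col u) -/(col v) cE bE.
have phi_edge i u v : (u, v) \in two_factor ms ->
    cycle_edge (p i.1) (phi i u).1 (phi i v).1.
  move/succE=> /=; case: (backward u) => ->.
    by exists (col u - 1)%R; right; rewrite subrK.
  by exists (col u); left.
pose H i := [set (phi i e.1, phi i e.2) | e in two_factor ms].
exists (K * (bool * bool))%type, H; split.
- move=> i; exists (phi i).
    apply: (inj_card_bij (@phi_inj i)).
    by rewrite card_two_factor_vertex card_prod card_bool card_Z // sumE mulnC.
  move=> u v; rewrite -(@mem_imset _ _ (fun e => (phi i e.1, phi i e.2))) //.
  by move=> [u1 v1] [u2 v2] [/= p1 b1 p2 b2]; congr pair; apply: (phi_inj i); congr pair.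
- move=> i e /imsetP[[u v] uv ->]; rewrite inE /=.
  exact: (sub _ _ _ (phi_edge i u v uv)).
- case=> [[x a] [y b]]; rewrite inE /= => /cov[k [c xy]].
  case: xy => [] [xE yE].
    have [u uc ub] := colP c false; have [v uv] := two_factor_succ m1 ge2 ev sumE u.
    (* The head v is already backward where the cycle of F turns; hence the correction of b. *)
    have [f [fa fb]] := label_surj c a (b (+) backward v) m2 m_odd.
    exists (k, f); apply/imsetP; exists (u, v) => //=.
    have vc : col v = (c + 1)%R by rewrite (succE _ _ uv) ub -/(col u) uc.
    by rewrite /phi /= vc uc ub xE yE fa fb addbF addbK.
  have [u uc ub] := colP (c + 1)%R true; have [v uv] := two_factor_succ m1 ge2 ev sumE u.
  have [f [fa fb]] := label_surj c (b (+) backward v) (~~ a) m2 m_odd.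
  exists (k, f); apply/imsetP; exists (u, v) => //=.
  have vc : col v = c by rewrite (succE _ _ uv) ub -/(col u) uc addrK.
  by rewrite /phi /= vc uc ub xE yE fa fb addbT negbK addbK.
- move=> [k f] [l g] e /imsetP[[u v] uv ->] /imsetP[[u' v'] uv' eE].
  have kl : k = l.
    have := phi_edge (l, g) _ _ uv'; have := phi_edge (k, f) _ _ uv.
    by case: eE => /= -> _ -> _; apply: uni.
  subst l; case: eE => /= /p_inj cu lu /p_inj cv lv; congr pair.
  (* A forward and a backward arc leaving the same column end in different columns, and here the
     columns of both ends agree. *)
  have bE : backward u = backward u'.
    move: (succE _ _ uv) (succE _ _ uv'); rewrite -/(col u) -/(col u') cu cv => -> /esym.
    by case: (backward u) (backward u') => [] [] // => [|/esym] h;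
      case: (Zp_succ_neq_pred m2 h).
  have uE : u = u' by apply: (bij_inj bij); rewrite -/(col u) -/(col u') cu bE.
  subst u'; have vE := two_factor_succ_inj uv uv'; subst v'.
  move/addIb: lu => lu; move/addIb: lv => lv.
  move: (succE _ _ uv); rewrite -/(col u); case: (backward u) => cE.
    apply: (@label_inj _ (col v)) => //.
    by rewrite cE subrK.
  by apply: (@label_inj _ (col u)) => //; rewrite -cE.
Qed.

(** * Connected 2-regular graphs are Hamiltonian cycles *)

Definition two_regular (V : eqType) (e : rel V) : Prop :=
  forall x, exists u v, u != v /\ forall y, e x y = (y == u) || (y == v).

Lemma two_regular_third (V : eqType) (e : rel V) x a b c :
  two_regular e -> e x a -> e x b -> a != b -> e x c -> c = a \/ c = b.
Proof.
move=> reg; case: (reg x) => u [v [uv eE]]; rewrite !eE.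
by move=> /orP[]/eqP-> /orP[]/eqP-> ab /orP[]/eqP->; auto; rewrite eqxx in ab.
Qed.

Section TwoRegular.

Variables (V : finType) (e : rel V).
Hypotheses (e_sym : symmetric e) (e_irr : irreflexive e) (e_reg : two_regular e).
Hypothesis e_conn : forall x y, connect e x y.

(** Take a longest duplicate-free path: a neighbour of an end outside it would extend it. *)
Lemma maximal_path (x0 : V) : exists x p, [/\ path e x p, uniq (x :: p),
  forall w, e x w -> w \in x :: p & forall w, e (last x p) w -> w \in x :: p].
Proof.
pose P n := [exists t : n.-tuple V, uniq t && sorted e t].
have P1 : exists n, P n.
  by exists 1; apply/existsP; exists [tuple x0].
have Pub n : P n -> n <= #|V|.
  by case/existsP=> t /andP[ut _]; rewrite -(size_tuple t) -(card_uniqP ut) max_card.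
case: (ex_maxnP P1 Pub) => n /existsP[t /andP[ut st]] max_n.
have size_t := size_tuple t; case: {t}(tval t) size_t ut st => [|x p] /= size_t ut st.
  suff /max_n : P 1 by rewrite -size_t.
  by apply/existsP; exists [tuple x0].
have maxP s : uniq s -> sorted e s -> size s <= n.
  move=> us ss; apply: max_n; apply/existsP; exists (in_tuple s).
  by rewrite us.
exists x, p; split=> // w ew; rewrite -[_ \in _]negbK; apply/negP=> wN.
  suff: size (w :: x :: p) <= n by rewrite -size_t ltnn.
  by apply: maxP => /=; rewrite ?wN // st 1?e_sym ew.
suff: size (rcons (x :: p) w) <= n by rewrite size_rcons -size_t ltnn.
by apply: maxP; rewrite ?rcons_uniq ?wN //= rcons_path st.
Qed.

(** Inner vertices of a maximal path have both neighbours on it, and the ends do by maximality, so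
    by connectedness it contains every vertex. The last vertex can only be adjacent to its
    predecessor and to the first vertex; having two neighbours, it closes the cycle. *)
Lemma hamiltonian_cycle (x0 : V) :
  exists s, [/\ uniq s, cycle e s & size s = #|V|].
Proof.
have [x [p [xp us nx nl]]] := maximal_path x0.
set s := x :: p in us nx nl.
have eS i : i < size p -> e (nth x s i) (nth x s i.+1) by apply: (pathP x xp).
have nthE i j : i <= size p -> j <= size p -> nth x s i = nth x s j -> i = j.
  by move=> ip jp /eqP; rewrite nth_uniq // => /eqP.
have lastE : last x p = nth x s (size p) by rewrite -[size p]/(size s).-1 nth_last.
have inner i w : 0 < i < size p -> e (nth x s i) w ->
    w = nth x s i.-1 \/ w = nth x s i.+1.
  move=> ip ew; apply: (two_regular_third e_reg) ew.
  - by rewrite e_sym -{2}(prednK (n:=i)) ?eS //; lia.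
  - by apply: eS; lia.
  - by apply/eqP=> /nthE; lia.
have closed_s y w : y \in s -> e y w -> w \in s.
  case/(nthP x)=> i; rewrite -[size s]/(size p).+1 ltnS leq_eqVlt => /orP[/eqP->|ip <- ew].
    by rewrite -lastE => <-; apply: nl.
  case: (posnP i) => [i0|i0]; first by move: ew; rewrite i0; apply: nx.
  have [|->|->] := inner i w _ ew; first by rewrite i0 ip.
    by apply: mem_nth; rewrite /s /=; lia.
  by apply: mem_nth; rewrite /s /=; lia.
have all_s y : y \in s.
  have /connectP[q xq ->] := e_conn x y.
  elim: q (x) xq (mem_head x p : x \in s) => //= z q IHq y0 /andP[e1 e2] y0s.
  by apply: (IHq z e2); apply: closed_s e1.
have last_nbr w : e (last x p) w -> w = x \/ w = nth x s (size p).-1.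
  move=> ew; have /(nthP x)[i ip iw] := nl w ew; rewrite -[size s]/(size p).+1 ltnS leq_eqVlt in ip.
  case/orP: ip => [/eqP ip|ip].
    by move: ew; rewrite -iw ip -lastE e_irr.
  case: (posnP i) => [i0|i0]; first by left; rewrite -iw i0.
  right; rewrite -iw; case: (inner i (last x p)).
  - by rewrite i0.
  - by rewrite iw e_sym.
  - by rewrite lastE => /nthE; lia.
  - by rewrite lastE => /nthE E; congr nth; lia.
exists s; split=> //.
  rewrite /= rcons_path xp; have [u [v [uv eE]]] := e_reg (last x p).
  have eu : e (last x p) u by rewrite eE eqxx.
  have ev : e (last x p) v by rewrite eE eqxx orbT.
  have [uE|uE] := last_nbr u eu; first by rewrite uE in eu.
  have [vE|vE] := last_nbr v ev; first by rewrite vE in ev.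
  by rewrite uE vE eqxx in uv.
by rewrite -(card_uniqP us); apply: eq_card => y; rewrite all_s.
Qed.

End TwoRegular.

Lemma ham_of_connected (m : nat) (e : rel 'Z_m) : 2 < m ->
  symmetric e -> irreflexive e -> two_regular e ->
  (forall x y, connect e x y) ->
  exists2 p : 'Z_m -> 'Z_m, injective p & forall x y, e x y <-> cycle_edge p x y.
Proof.
move=> m2 e_sym e_irr e_reg e_conn; have m1 : 1 < m by exact: ltnW.
have [s [us cs ss]] := hamiltonian_cycle e_sym e_irr e_reg e_conn 0%R.
rewrite card_Z // in ss.
have ltm (i : 'Z_m) : (i : nat) < m by rewrite -[m in _ < m]Zp_cast // ltn_ord.
pose p (i : 'Z_m) := nth 0%R s i.
have p_inj : injective p.
  move=> i j /eqP; rewrite nth_uniq ?ss //.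
  by move/eqP/val_inj.
have p_surj y : exists i, p i = y.
  by have [q _ qK] := injF_bij p_inj; exists (q y); rewrite qK.
have eS i : e (p i) (p (i + 1)%R).
  rewrite /p val_Zp_add1 //; case: s us cs ss @p p_inj p_surj => [|x q] us cs ss p _ _.
    by move: ss; rewrite /=; lia.
  have := pathP 0%R cs i; rewrite size_rcons -[(size q).+1]/(size (x :: q)) ss ltm.
  move/(_ isT); rewrite -rcons_cons nth_rcons ss ltm nth_rcons.
  have -> : size q = m.-1 by move: ss => /=; lia.
  case: eqP => iE; last by rewrite /= ifT //; move: (ltm i); lia.
  by rewrite iE ltnn.
have eP i : e (p i) (p (i - 1)%R) by rewrite e_sym -{2}(subrK 1%R i).
exists p => // x y; split=> [exy|[i [] [-> ->]]]; [|exact: eS|by rewrite e_sym].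
have [i iE] := p_surj x; rewrite -iE in exy *.
case: (two_regular_third e_reg (eS i) (eP i) _ exy) => [|->|->].
- by apply/eqP=> /p_inj; apply: Zp_succ_neq_pred.
- by exists i; left.
- by exists (i - 1)%R; right; rewrite subrK.
Qed.

(** * Congruences and walks *)

Lemma eqmod_near d x y : x < y + d -> y < x + d -> x = y %[mod d] -> x = y.
Proof.
wlog xy : x y / x <= y => [IH xd yd E|_ yd /eqP].
  by case/orP: (leq_total x y) => [/IH|/IH] W; [|symmetry]; apply: W.
rewrite eq_sym eqn_mod_dvd // => /dvdnP[[|q] E]; first by lia.
by move: E; rewrite mulSn; lia.
Qed.

Lemma eqmod_mulr_coprime d x y z : coprime d z ->
  x * z = y * z %[mod d] -> x = y %[mod d].
Proof.
move=> dz; wlog xy : x y / x <= y => [IH E|/eqP].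
  by case/orP: (leq_total x y) => [/IH|/IH] W; [|symmetry]; apply: W.
rewrite eq_sym eqn_mod_dvd ?leq_mul2r ?xy ?orbT // -mulnBl Gauss_dvdl //.
by rewrite -eqn_mod_dvd // => /eqP.
Qed.

Section Walks.

Variables (V : finType) (e : rel V).
Hypothesis e_sym : symmetric e.

Lemma connect_walk (f : nat -> V) lo hi : lo <= hi ->
  (forall k, lo <= k < hi -> e (f k) (f k.+1)) -> connect e (f lo) (f hi).
Proof.
elim: hi => [|hi IH]; first by rewrite leqn0 => /eqP->.
rewrite leq_eqVlt => /orP[/eqP-> //|lo_hi] ef.
apply: (connect_trans (IH lo_hi _)); first by move=> k ?; apply: ef; lia.
by apply/connect1/ef; lia.
Qed.

(** At most one step of the walk fails to be an edge. If it precedes k, the part from k to n is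
    intact; otherwise the part from 0 to k is. *)
Lemma connect_walk_end (f : nat -> V) n k : k <= n ->
  (forall k1 k2, k1 < n -> k2 < n -> ~~ e (f k1) (f k1.+1) ->
     ~~ e (f k2) (f k2.+1) -> k1 = k2) ->
  connect e (f k) (f 0) \/ connect e (f k) (f n).
Proof.
move=> kn uniq_cut; case: (boolP [forall i : 'I_k, e (f i) (f i.+1)]).
  move/forallP=> ef; left; rewrite (sym_connect_sym e_sym).
  by apply: connect_walk => // i /= ik; apply: (ef (Ordinal ik)).
rewrite negb_forall => /existsP[i cut_i]; right.
apply: connect_walk => // j /andP[kj jn]; apply/negPn/negP=> cut_j.
have := uniq_cut i j _ jn cut_i cut_j; have := ltn_ord i; lia.
Qed.

End Walks.

(** * The grid of the vertices i b + j a *)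

Section Grid.

Definition grid (m a b i j : nat) : 'Z_m := (i * b + j * a)%:R%R.

Lemma gridC m a b i j : grid m a b i j = grid m b a j i.
Proof. by rewrite /grid addnC. Qed.

Lemma grid_addb m a b i j : (grid m a b i j + b%:R)%R = grid m a b i.+1 j.
Proof. by rewrite /grid -natrD mulSn; congr (_%:R)%R; lia. Qed.

Lemma grid_adda m a b i j : (grid m a b i j + a%:R)%R = grid m a b i j.+1.
Proof. by rewrite gridC grid_addb gridC. Qed.

Variables (m a b : nat).
Hypotheses (m_gt1 : 1 < m) (co : coprime (gcdn a m) (gcdn b m)).
Let g := gcdn a m.
Let r := m %/ g.

(** Modulo g the term j a vanishes, and b is invertible because gcd(a, m) and gcd(b, m) are
    coprime. *)
Lemma grid_row i j i' j' :
  grid m a b i j = grid m a b i' j' -> i = i' %[mod g].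
Proof.
move/eqP; rewrite eq_Zp_nat // => /eqP E.
have gm : g %| m by apply: dvdn_gcdr.
have ga : a %% g = 0 by apply/eqP; apply: dvdn_gcdl.
have gb : coprime g b.
  rewrite /coprime -dvdn1 -(eqP co) dvdn_gcd dvdn_gcdl dvdn_gcd dvdn_gcdr /=.
  by apply: dvdn_trans gm; apply: dvdn_gcdl.
apply: (eqmod_mulr_coprime gb); have := congr1 (modn^~ g) E.
rewrite !modn_dvdm // -(modnDmr (i * b)) -(modnDmr (i' * b)).
by rewrite -(modnMmr j) -(modnMmr j') ga !muln0 mod0n !addn0.
Qed.

(** Dividing j a = j' a (mod m) by g leaves the factor a / g, which is invertible modulo r. *)
Lemma grid_row_eq i j j' : grid m a b i j = grid m a b i j' -> j = j' %[mod r].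
Proof.
move/eqP; rewrite eq_Zp_nat // eqn_modDl => /eqP E.
have g0 : 0 < g by rewrite gcdn_gt0 (ltnW m_gt1) orbT.
have mE : m = g * r by rewrite mulnC divnK // dvdn_gcdr.
have aE : a = g * (a %/ g) by rewrite mulnC divnK // dvdn_gcdl.
have ra : coprime r (a %/ g).
  rewrite /coprime -(eqn_pmul2l g0) muln1 muln_gcdr -mE -aE gcdnC.
  by rewrite eqxx.
apply: (eqmod_mulr_coprime ra).
have gE x : x * a = g * (x * (a %/ g)) by rewrite mulnCA -aE.
by move/eqP: E; rewrite !gE mE -!muln_modr eqn_pmul2l // => /eqP.
Qed.

Lemma grid_period i j k : grid m a b i (j + k * r) = grid m a b i j.
Proof.
apply/eqP; rewrite eq_Zp_nat // eqn_modDl mulnDl -[X in _ == X %[mod _]]addn0.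
rewrite eqn_modDl mod0n -/(dvdn _ _).
have mE : m = g * r by rewrite mulnC divnK // dvdn_gcdr.
by rewrite -mulnA dvdn_mull // {1}mE mulnC dvdn_mul // dvdn_gcdl.
Qed.

Lemma grid_from s i j : exists2 k, k < r & grid m a b i j = grid m a b i (s + k).
Proof.
have r0 : 0 < r.
  rewrite divn_gt0; first by apply: dvdn_leq; [exact: ltnW | apply: dvdn_gcdr].
  by rewrite gcdn_gt0 (ltnW m_gt1) orbT.
(* This is j - s modulo r, with [s * r.-1] standing for -s. *)
exists ((j + s * r.-1) %% r); first by rewrite ltn_mod.
rewrite -(grid_period i j s) -(grid_period _ (s + _) ((j + s * r.-1) %/ r)).
congr grid; rewrite -addnA (addnC (_ %% _)) -divn_eq addnCA; congr (_ + _).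
by rewrite -{1}(prednK r0) mulnS.
Qed.

(** The g r = m pairs with i < g and j < r give distinct vertices, hence all of them. *)
Lemma grid_surj v : exists i j, [/\ i < g, j < r & v = grid m a b i j].
Proof.
pose f (x : 'I_g * 'I_r) := grid m a b x.1 x.2.
have f_inj : injective f.
  move=> [i j] [i' j'] E; have := grid_row E.
  rewrite !modn_small ?ltn_ord //= => /val_inj ii'; rewrite /f ii' in E *.
  have := grid_row_eq E; rewrite !modn_small ?ltn_ord //= => /val_inj.
  by move=> ->.
have [|q _ qK] := inj_card_bij f_inj _.
  by rewrite card_prod !card_ord Zp_cast // /r mulnC divnK // dvdn_gcdr.
by case: (q v) (qK v) => i j <-; exists i, j; split.
Qed.

End Grid.

(** * Exchanging sides of parallelograms *)

(* [sides T A] consists of the tails of the B-edges of the parallelograms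
   x, x + A, x + B, x + A + B with [T x]. Hence [colour A B (sides T B) (sides T A)]
   and [colour B A (sides T A) (sides T B)] are the A-edges and the B-edges with
   the sides of these parallelograms exchanged. *)
Section Colour.

Variable m : nat.
Implicit Types (A B x y : 'Z_m) (T X Y : pred 'Z_m).

Definition step A B X Y x y :=
  (y == x + A)%R && ~~ X x || (y == x + B)%R && Y x.
Definition colour A B X Y : rel 'Z_m :=
  fun x y => step A B X Y x y || step A B X Y y x.
Definition sides T A : pred 'Z_m := fun x => T x || T (x - A)%R.

Lemma colour_sym A B X Y : symmetric (colour A B X Y).
Proof. by move=> x y; rewrite /colour orbC. Qed.

Lemma colour_irr A B X Y : A != 0%R -> B != 0%R -> irreflexive (colour A B X Y).
Proof.
have neq C : C != 0%R -> forall x, (x == x + C)%R = false.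
  by move=> C0 x; rewrite -{1}[x]addr0 (inj_eq (addrI x)) eq_sym (negbTE C0).
by move=> A0 B0 x; rewrite /colour /step !neq.
Qed.

(** Each parallelogram with corner x trades one A-edge at x for one B-edge. The hypotheses forbid
    two of them to share a side, so at most two, in opposite position, meet at x, and these trade
    different edges. *)
Lemma colour_regular A B T :
  (A != - A)%R -> (B != - B)%R -> (A != B)%R -> (A != - B)%R ->
  (forall x, T x -> ~~ T (x + A)%R) -> (forall x, T x -> ~~ T (x + B)%R) ->
  two_regular (colour A B (sides T B) (sides T A)).
Proof.
move=> AA BB AB ANB noA noB x.
have nb y : colour A B (sides T B) (sides T A) x y =
    [|| (y == x + A)%R && ~~ (T x || T (x - B)%R),
        (y == x + B)%R && (T x || T (x - A)%R),
        (y == x - A)%R && ~~ (T (x - A)%R || T (x - A - B)%R) |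
        (y == x - B)%R && (T (x - B)%R || T (x - A - B)%R)].
  rewrite /colour /step /sides -orbA; congr [|| _, _ | _].
  rewrite -[in RHS](inj_eq (addIr A) y) -[in RHS](inj_eq (addIr B) y) !subrK.
  rewrite !(eq_sym x); congr (_ || _).
    by case: eqP => //= yE; rewrite -(addrK A y) yE.
  by case: eqP => //= yE; rewrite -(addrK B y) yE -!addrA (addrC (- A)%R).
have xA := noA (x - A)%R; have xB := noB (x - B)%R.
have xAB := noA (x - A - B)%R; have xBA := noB (x - A - B)%R.
rewrite subrK in xA; rewrite subrK in xB; rewrite subrK in xBA.
rewrite (_ : x - A - B + A = x - B)%R in xAB; last by ring.
have neq C D : C != D -> (x + C != x + D)%R by rewrite (inj_eq (addrI x)).
have NAB : (- A != - B)%R by rewrite eqr_opp.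
have BNA : (B != - A)%R by rewrite -eqr_oppLR eq_sym.
move: (neq _ _ AA) (neq _ _ BB) (neq _ _ AB) (neq _ _ ANB) (neq _ _ NAB) (neq _ _ BNA).
move=> {AA BB AB ANB NAB BNA neq} AA BB AB ANB NAB BNA.
(* Each admissible pattern of the four parallelograms with corner x leaves one of the six pairs of
   neighbours. *)
case: (T x) (T (x - A)%R) (T (x - B)%R) (T (x - A - B)%R) xA xB xAB xBA nb =>
  [] [] [] [] xA xB xAB xBA nb;
  try (by move: (xA isT)); try (by move: (xB isT)); try (by move: (xAB isT));
  try (by move: (xBA isT));
  first [ exists (x + A)%R, (x + B)%R; split; [done | by move=> y; rewrite nb /= ?andbT ?andbF ?orbF]
        | exists (x + A)%R, (x - A)%R; split; [done | by move=> y; rewrite nb /= ?andbT ?andbF ?orbF]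
        | exists (x + A)%R, (x - B)%R; split; [done | by move=> y; rewrite nb /= ?andbT ?andbF ?orbF]
        | exists (x + B)%R, (x - A)%R; split; [done | by move=> y; rewrite nb /= ?andbT ?andbF ?orbF]
        | exists (x + B)%R, (x - B)%R; split; [done | by move=> y; rewrite nb /= ?andbT ?andbF ?orbF]
        | exists (x - A)%R, (x - B)%R; split; [done | by move=> y; rewrite nb /= ?andbT ?andbF ?orbF]].
Qed.

End Colour.

(** * Connectedness of the two recoloured 2-factors *)

(* The vertex i b + j a is in row i < g and in column j < h; rows have length r
   and columns length N. The parallelogram between rows i and i + 1 starts in
   position [c i] of row i. The first [K] of them alternate between positions 0
   and 1: the recoloured columns 0, 1, 2 get a path winding through
   rows 1, ..., K - 1 of all three. Each later one joins a new column to the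
   preceding one. *)
Section TwoColouring.

Variables (m a b g h r N K : nat) (c : nat -> nat).

Let A : 'Z_m := a%:R%R.
Let B : 'Z_m := b%:R%R.
Let vtx := grid m a b.

Hypothesis rowE : forall i j i' j', vtx i j = vtx i' j' -> i = i' %[mod g].
Hypothesis rowE2 : forall i j j', vtx i j = vtx i j' -> j = j' %[mod r].
Hypothesis colE : forall i j i' j', vtx i j = vtx i' j' -> j = j' %[mod h].
Hypothesis colE2 : forall i i' j, vtx i j = vtx i' j -> i = i' %[mod N].
Hypothesis row_from : forall s i j, exists2 k, k < r & vtx i j = vtx i (s + k).
Hypothesis col_from : forall s i j, exists2 k, k < N & vtx i j = vtx (s + k) j.
Hypothesis row_wrap : forall i j, vtx i (j + r) = vtx i j.
Hypothesis col_wrap : forall i j, vtx (i + N) j = vtx i j.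
Hypothesis row_surj : forall v, exists i j, i < g /\ v = vtx i j.
Hypothesis col_surj : forall v, exists i j, j < h /\ v = vtx i j.

Hypotheses (r_ge3 : 3 <= r) (gN : g <= N) (hg : h < g) (h_ge3 : h != 1 -> 3 <= h).
Hypotheses (K_even : ~~ odd K) (K_ge2 : 2 <= K) (K_lt : K < g).
Hypothesis K_h : h != 1 -> K = g - h + 2.
Hypothesis c_small : forall i, i < K -> c i = odd i.
Hypothesis c_big : forall i, K <= i -> c i = i - K + 2.
Hypothesis c_lt_r : forall i, i < g.-1 -> c i + 2 <= r.
Hypothesis c_lt_h : forall i, h != 1 -> i < g.-1 -> c i + 2 <= h.
Hypothesis turn : h = 1 -> exists n,
  [/\ K.+1 = g, g <= n, 2 * n + g <= m, N = m & forall i j, vtx i j = vtx (i + j * n) 0].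

Definition squares : pred 'Z_m := fun x => x \in [seq vtx i (c i) | i <- iota 0 g.-1].

Let X := sides squares B.
Let Y := sides squares A.
Definition row_colour := colour A B X Y.
Definition col_colour := colour B A Y X.

Let c_le1 i : c i <= 1 -> i < K.
Proof. by case: (ltnP i K) => // iK; rewrite c_big //; lia. Qed.
Let cK i : 2 <= c i -> i = K + c i - 2.
Proof.
case: (ltnP i K) => iK; last by rewrite c_big //; lia.
by rewrite c_small //; case: (odd i).
Qed.
Let cS i : c i.+1 != c i.
Proof.
case: (ltnP i.+1 K) => iK; first by rewrite !c_small //=; [case: (odd i) | lia].
rewrite [c i.+1]c_big //; case: (ltnP i K) => iK'.
  by rewrite c_small //; case: (odd i); lia.
by rewrite c_big //; lia.
Qed.

Let squareP i j : squares (vtx i j) -> exists2 i', i' < g.-1 & vtx i j = vtx i' (c i').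
Proof. by case/mapP=> i'; rewrite mem_iota => ig ->; exists i'. Qed.
Let square_in i : i < g.-1 -> squares (vtx i (c i)).
Proof. by move=> ig; apply/mapP; exists i; rewrite ?mem_iota. Qed.

(** Only the parallelogram of the next row could start there, and [cS] gives it another position. *)
Lemma squares_b x : squares x -> ~~ squares (x + B)%R.
Proof.
case/mapP=> i; rewrite mem_iota => ig ->; rewrite /vtx grid_addb.
apply/negP=> /squareP[i' i'g E].
have ii' : i.+1 = i' by apply: (eqmod_near _ _ (rowE E)); lia.
move: E; rewrite -ii' => /rowE2 /eqmod_near E.
have := c_lt_r ig; have := c_lt_r i'g; rewrite -ii' => ci ci'.
by case/eqP: (cS i); rewrite E //; lia.
Qed.

(** At most one parallelogram starts in each row. *)
Lemma squares_a x : squares x -> ~~ squares (x + A)%R.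
Proof.
case/mapP=> i; rewrite mem_iota => ig ->; rewrite /vtx grid_adda.
apply/negP=> /squareP[i' i'g E].
have ii' : i = i' by apply: (eqmod_near _ _ (rowE E)); lia.
by move: E; rewrite -ii' => /rowE2 /eqmod_near E; have := c_lt_r ig; lia.
Qed.

Let XP i j : X (vtx i j) -> exists2 i', i' < g.-1 &
  vtx i j = vtx i' (c i') \/ vtx i j = vtx i'.+1 (c i').
Proof.
case/orP=> [/squareP[i' ? ?]|/mapP[i']]; first by exists i'; auto.
rewrite mem_iota => ig /eqP; rewrite subr_eq /vtx grid_addb => /eqP E.
by exists i'; auto.
Qed.

Let YP i j : Y (vtx i j) -> exists2 i', i' < g.-1 &
  vtx i j = vtx i' (c i') \/ vtx i j = vtx i' (c i').+1.
Proof.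
case/orP=> [/squareP[i' ? ?]|/mapP[i']]; first by exists i'; auto.
rewrite mem_iota => ig /eqP; rewrite subr_eq /vtx grid_adda => /eqP E.
by exists i'; auto.
Qed.

Let X_in i : i < g.-1 -> X (vtx i (c i)).
Proof. by move=> ig; rewrite /X /sides square_in. Qed.
Let X_inS i : i < g.-1 -> X (vtx i.+1 (c i)).
Proof.
by move=> ig; rewrite /X /sides /vtx -grid_addb addrK square_in ?orbT.
Qed.
Let Y_in i : i < g.-1 -> Y (vtx i (c i)).
Proof. by move=> ig; rewrite /Y /sides square_in. Qed.
Let Y_inS i : i < g.-1 -> Y (vtx i (c i).+1).
Proof.
by move=> ig; rewrite /Y /sides /vtx -grid_adda addrK square_in ?orbT.
Qed.

Let row_a i j : ~~ X (vtx i j) -> row_colour (vtx i j) (vtx i j.+1).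
Proof. by move=> nX; rewrite /row_colour /colour /step nX /vtx grid_adda eqxx. Qed.
Let row_b i j : Y (vtx i j) -> row_colour (vtx i j) (vtx i.+1 j).
Proof. by move=> nX; rewrite /row_colour /colour /step nX /vtx grid_addb eqxx orbT. Qed.
Let col_b i j : ~~ Y (vtx i j) -> col_colour (vtx i j) (vtx i.+1 j).
Proof. by move=> nX; rewrite /col_colour /colour /step nX /vtx grid_addb eqxx. Qed.
Let col_a i j : X (vtx i j) -> col_colour (vtx i j) (vtx i j.+1).
Proof. by move=> nX; rewrite /col_colour /colour /step nX /vtx grid_adda eqxx orbT. Qed.

Let row_sym : symmetric row_colour. Proof. exact: colour_sym. Qed.
Let col_sym : symmetric col_colour. Proof. exact: colour_sym. Qed.
Let crow_sym := sym_connect_sym row_sym.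
Let ccol_sym := sym_connect_sym col_sym.

(** Row i + 1 loses its edge at [c i], a side of parallelogram i, and at most one more, a side of
    parallelogram i + 1. Cut open at the first, it is a walk with at most one missing step. *)
Let row_line i j : i.+1 < g ->
  connect row_colour (vtx i.+1 j) (vtx i.+1 (c i)) \/
  connect row_colour (vtx i.+1 j) (vtx i.+1 (c i).+1).
Proof.
move=> ig; have [k kr ->] := row_from (c i).+1 i.+1 j.
rewrite -[vtx i.+1 (c i)]row_wrap -[in vtx _ (c i).+1](addn0 (c i).+1).
rewrite (_ : c i + r = (c i).+1 + r.-1); last by lia.
have := @connect_walk_end _ _ row_sym (fun k => vtx i.+1 ((c i).+1 + k)) r.-1 k.
case; [by lia | | by right | by left] => k1 k2 k1r k2r.
have cut k' : k' < r.-1 -> ~~ row_colour (vtx i.+1 ((c i).+1 + k')) (vtx i.+1 ((c i).+1 + k'.+1)) ->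
    i.+1 < g.-1 /\ (c i).+1 + k' = c i.+1 %[mod r].
  move=> k'r; rewrite addnS => /(contraR (@row_a _ _)) /XP[i' i'g].
  case=> E; have ii' := eqmod_near _ _ (rowE E).
    have {}ii' : i.+1 = i' by apply: ii'; lia.
    by move: E; rewrite -ii' => /rowE2; split=> //; rewrite ii'.
  have {}ii' : i = i' by apply/eq_add_S/ii'; lia.
  by move: E; rewrite -ii' => /rowE2/eqmod_near; lia.
move=> /(cut _ k1r)[_ E1] /(cut _ k2r)[_ E2].
by apply/(@addnI (c i).+1)/(@eqmod_near r); [lia | lia | rewrite E1 E2].
Qed.

(** By induction every row is joined to row 0: both corners of parallelogram i in row i + 1 have
    gained a b-edge down to row i. Row 0 itself loses a single edge and remains a path. *)
Lemma row_connected x y : connect row_colour x y.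
Proof.
suff to0 i j : i < g -> connect row_colour (vtx i j) (vtx 0 (c 0).+1).
  have [i [j [ig ->]]] := row_surj x.
  have [i' [j' [i'g ->]]] := row_surj y.
  by rewrite (connect_trans (to0 _ _ ig)) // crow_sym to0.
elim: i j => [|i IH] j ig.
  have [k kr ->] := row_from (c 0).+1 0 j.
  rewrite crow_sym -{1}[(c 0).+1]addn0.
  apply: (@connect_walk _ _ (fun k => vtx 0 ((c 0).+1 + k))) => // k' k'k.
  rewrite addnS; apply: row_a; apply/negP=> /XP[i' i'g] [] E;
    have := eqmod_near _ _ (rowE E).
    move=> ii'; have {}ii' : 0 = i' by apply: ii'; lia.
    by move: E; rewrite -ii' => /rowE2/eqmod_near; lia.
  by lia.
have [|] := row_line j ig => H; apply: (connect_trans H); rewrite crow_sym.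
  apply: (connect_trans (y := vtx i (c i))); rewrite crow_sym ?IH ?(ltnW ig) //.
  by rewrite connect1 // row_sym row_b // Y_in //; lia.
apply: (connect_trans (y := vtx i (c i).+1)); rewrite crow_sym ?IH ?(ltnW ig) //.
by rewrite connect1 // row_sym row_b // Y_inS //; lia.
Qed.

(** Row i contains a side of parallelogram i - 1 and one of parallelogram i, at positions 0 and 1 in
    some order. *)
Let col_inner i : 0 < i < K ->
  connect col_colour (vtx i 0) (vtx i 1) /\ connect col_colour (vtx i 1) (vtx i 2).
Proof.
case: i => // i /andP[_ iK].
have Xi : X (vtx i.+1 (c i.+1)) by apply: X_in; lia.
have Xi' : X (vtx i.+1 (c i)) by apply: X_inS; lia.
move: Xi Xi'; rewrite !c_small //=; last by lia.
by case: (odd i) => /= Xi Xi'; split; apply/connect1/col_a.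
Qed.

(** Parallelogram i removes the b-edges of columns [c i] and [c i + 1] from row i; among columns 0,
    1, 2 just this one keeps its edge. *)
Let col_up i : i < K ->
  connect col_colour (vtx i (if odd i then 0 else 2)) (vtx i.+1 (if odd i then 0 else 2)).
Proof.
move=> iK; apply/connect1/col_b/negP=> /YP[i' i'g] E.
have ii' : i = i' by case: E => /rowE/eqmod_near; lia.
move: E; rewrite -ii' c_small //.
by case: (odd i) => /= -[] /rowE2/eqmod_near; lia.
Qed.

Let hub := vtx 1 0.

Let snake i j : 0 < i < K -> j <= 2 -> connect col_colour hub (vtx i j).
Proof.
case: i => // i /= iK j2.
suff H : connect col_colour hub (vtx i.+1 1).
  have [H0 H2] := @col_inner i.+1 iK.
  move: j j2 => [|[|[|]]] // _; apply: (connect_trans H) => //.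
  by rewrite ccol_sym.
elim: i iK => [|i IH] iK; first by case: (@col_inner 1 iK).
have [H0 H2] := @col_inner i.+1 (ltnW iK); have [H0' H2'] := @col_inner i.+2 iK.
apply: (connect_trans (IH (ltnW iK))).
have := @col_up i.+1 (ltnW iK); case: ifP => _ H.
  by apply: connect_trans H0'; apply: connect_trans H; rewrite ccol_sym.
by rewrite ccol_sym in H2'; apply: connect_trans H2'; apply: connect_trans H.
Qed.

Let snake_bottom : connect col_colour hub (vtx 0 2).
Proof.
apply: (@connect_trans _ _ (vtx 1 2)); first by apply: snake.
by rewrite ccol_sym; apply: (@col_up 0); lia.
Qed.

Let snake_top : connect col_colour hub (vtx K 0).
Proof.
have K1 : K.-1.+1 = K by lia.
apply: (@connect_trans _ _ (vtx K.-1 0)); first by apply: snake; lia.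
have := @col_up K.-1; rewrite K1 (_ : odd K.-1) => [|]; last by lia.
by apply; lia.
Qed.

Let bottom_edge : connect col_colour (vtx 0 0) (vtx 0 1).
Proof.
apply/connect1/col_a; have := @X_in 0; rewrite c_small //=; last by lia.
by apply; lia.
Qed.

Let top_edge : connect col_colour (vtx K 1) (vtx K 2).
Proof.
have K1 : K.-1.+1 = K by lia.
apply/connect1/col_a; have := @X_inS K.-1; rewrite c_small //=; last by lia.
by rewrite K1 (_ : odd K.-1) => [|]; [apply; lia | lia].
Qed.

Let col_walk j lo hi : lo <= hi -> (forall k, lo <= k < hi -> ~~ Y (vtx k j)) ->
  connect col_colour (vtx lo j) (vtx hi j).
Proof.
move=> lohi nY; apply: (@connect_walk _ _ (fun k => vtx k j)) => // k kb.
exact/col_b/nY.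
Qed.

Let hub_sym x : connect col_colour x hub = connect col_colour hub x.
Proof. by rewrite ccol_sym. Qed.

Let to_hub_above x y : connect col_colour x y -> connect col_colour hub y ->
  connect col_colour hub x.
Proof. by move=> xy hy; apply: connect_trans hy _; rewrite ccol_sym. Qed.

Let to_hub_below x y : connect col_colour x y -> connect col_colour hub x ->
  connect col_colour hub y.
Proof. by move=> xy hx; apply: connect_trans hx _. Qed.

(* One column: [2 * n < m] makes the three strips of the snake occur in the
   order 0, 1, 2 along the cycle of b-edges, so that rewiring keeps it a single
   cycle. *)
Let one_column x : h = 1 -> connect col_colour hub x.
Proof.
move=> h1; have [n [KE gn nm NE vE]] := turn h1.
have [i [j [jh ->]]] := col_surj x; have {jh}-> : j = 0 by lia.
have [k kN ->] := col_from 0 i 0; rewrite add0n NE in kN *.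
have cut k' : k' < m -> Y (vtx k' 0) ->
    exists i' t, [/\ i' < K, t <= 2 & k' = i' + t * n].
  move=> k'm /YP[i' i'g]; have i'K : i' < K by lia.
  have c1 : c i' <= 1 by rewrite c_small //; case: (odd i').
  have c2 : c i' * n <= n by rewrite -[leqRHS]mul1n leq_mul2r c1 orbT.
  rewrite (vE i' (c i')) (vE i' (c i').+1) mulSn => -[] /colE2; rewrite NE => /eqmod_near E.
    by exists i', (c i'); split; [| lia | apply: E; lia].
  by exists i', (c i').+1; split; [| lia | rewrite mulSn; apply: E; lia].
have walk t hi : t <= 2 -> t * n + K <= hi <= (if t == 2 then m else t.+1 * n) ->
    connect col_colour (vtx (t * n + K) 0) (vtx hi 0).
  move=> t2 hib; apply: col_walk; first by lia.
  move=> k' k'b; apply/negP=> /cut[|i' [t' [i'K t'2]]].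
    by case: t t2 hib k'b => [|[|[|]]] //= _; lia.
  by case: t t2 hib k'b => [|[|[|]]] // _;
     case: t' t'2 => [|[|[|]]] // _; rewrite ?mulSn ?mul0n /=; lia.
(* Between the strips, the cycle of b-edges leads from (K, 0) to (0, 1), from (K, 1) to (0, 2) and
   from (K, 2) to (0, 0). With the edges (0, 0)(0, 1) and (K, 1)(K, 2), all these ends are joined to
   the snake. *)
have h01 : connect col_colour hub (vtx 0 1).
  by rewrite vE mul1n; apply: (to_hub_below (walk 0 n _ _)) => //=; lia.
have h00 := to_hub_above bottom_edge h01.
have hK2 : connect col_colour hub (vtx K 2).
  apply: to_hub_above h00; rewrite vE addnC -[vtx 0 0]col_wrap add0n NE.
  by apply: walk => //=; lia.
have hK1 := to_hub_above top_edge hK2.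
have strip i' t : i' < K -> t <= 2 -> connect col_colour hub (vtx (i' + t * n) 0).
  move=> i'K t2; rewrite -vE; case: (posnP i') => [->|i'0].
    by case: t t2 => [|[|[|]]].
  by apply: snake; rewrite ?i'0.
have over t hi : t <= 2 -> t * n + K <= hi <= (if t == 2 then m else t.+1 * n) ->
    connect col_colour hub (vtx hi 0).
  move=> t2 hib; apply: (to_hub_below (walk t hi t2 hib)).
  by rewrite addnC -vE; case: t t2 {hib} => [|[|[|]]].
move=> {h01 h00 hK1 hK2}; case: (ltnP k n) => kn.
  case: (ltnP k K) => kK; last by apply: (over 0) => //=; lia.
  by have := @strip k 0 kK isT; rewrite mul0n addn0.
case: (ltnP k (2 * n)) => k2n.
  case: (ltnP k (n + K)) => kK; last by apply: (over 1) => //=; lia.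
  have := @strip (k - n) 1 _ isT; rewrite mul1n subnK //; apply; lia.
case: (ltnP k (2 * n + K)) => kK; last by apply: (over 2) => //=; lia.
have := @strip (k - 2 * n) 2 _ isT; rewrite subnK //; apply; lia.
Qed.

(** From the snake go to (K, 0), along column 0 round to (0, 0), across to (0, 1), back along column
    1 to (K, 1) and across to (K, 2). The rest of column 2 is reached from (0, 2), the other end of
    the snake. *)
Let first_columns i j : h != 1 -> j <= 2 -> connect col_colour hub (vtx i j).
Proof.
move=> h1 j2; have h3 := h_ge3 h1; have KE := K_h h1.
have [k kN ->] := col_from 0 i j; rewrite add0n.
(* A b-edge missing from these columns starts in a row at most K; row K occurs only in column 2,
   where parallelogram K would start. *)
have cut k' j' : k' < N -> j' <= 2 -> Y (vtx k' j') ->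
    k' <= K /\ (j' <= 1 -> k' < K).
  move=> k'N j'2 /YP[i' i'g] E; have ch := c_lt_h h1 i'g.
  have i'K : c i' <= 2 -> i' <= K.
    case: (leqP (c i') 1) => [/c_le1/ltnW //|c2 c3].
    by have := cK c2; lia.
  case: E => E.
    have cj : j' = c i' by apply: (eqmod_near _ _ (colE E)); lia.
    have ki : k' = i' by move: E; rewrite cj => /colE2/eqmod_near; apply; lia.
    split; first by rewrite ki; apply: i'K; lia.
    by move=> j1; rewrite ki; apply: c_le1; lia.
  have cj : j' = (c i').+1 by apply: (eqmod_near _ _ (colE E)); lia.
  have ki : k' = i' by move: E; rewrite cj => /colE2/eqmod_near; apply; lia.
  have {}i'K : i' < K by apply: c_le1; lia.
  by split=> [|_]; lia.
have up k' j' : j' <= 2 -> K + (j' == 2) <= k' <= N ->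
    connect col_colour (vtx k' j') (vtx 0 j').
  move=> j'2 k'b; rewrite -[vtx 0 j']col_wrap add0n; apply: col_walk; first by lia.
  by move=> k1 k1b; apply/negP=> /cut[|//|k1K k1K']; lia.
have KN : K + 0 <= K <= N by lia.
have h00 := to_hub_below (@up K 0 isT KN) snake_top.
have h01 := to_hub_below bottom_edge h00.
have hK2 := to_hub_below top_edge (to_hub_above (@up K 1 isT KN) h01).
have h0 j' : j' <= 2 -> connect col_colour hub (vtx 0 j').
  by case: j' => [|[|[|]]] // _; apply: snake_bottom.
case: (ltnP k K) => kK.
  by case: (posnP k) => [->|k0]; [apply: h0 | apply: snake; rewrite ?k0].
have [kK2|kK2] := boolP ((k == K) && (j == 2)).
  by case/andP: kK2 => /eqP-> /eqP->.
move=> {h00 h01 hK2}; apply: to_hub_above (h0 j j2); apply: up => //.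
by move: kK2; case: (j == 2) => //=; lia.
Qed.

(** Parallelogram s, with [c s = j], joins column j + 1 to column j in rows s and s + 1. Without its
    b-edge from row s, column j + 1 is a walk between these two rows that misses at most the edge
    from row s + 1, so each of its vertices reaches one of them. *)
Let later_columns i j : h != 1 -> j < h -> connect col_colour hub (vtx i j).
Proof.
move=> h1; have h3 := h_ge3 h1; have KE := K_h h1.
elim: j i => [|j IH] i jh; first exact: first_columns.
case: (ltnP j 2) => j2; first exact: first_columns.
pose s := K + j - 2; have sg : s < g.-1 by rewrite /s; lia.
have cs : c s = j by rewrite /s c_big; lia.
have hs i' : connect col_colour hub (vtx i' j) by apply: IH; lia.
have [k kN ->] := col_from s.+1 i j.+1.
have sN : s.+1 + N.-1 = s + N by lia.
have := @connect_walk_end _ _ col_sym (fun k => vtx (s.+1 + k) j.+1) N.-1 k.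
rewrite addn0 sN col_wrap; case; first by lia.
- move=> k1 k2 k1N k2N.
  have cut k' : k' < N.-1 -> ~~ col_colour (vtx (s.+1 + k') j.+1) (vtx (s.+1 + k'.+1) j.+1) ->
      s.+1 + k' = s.+1 %[mod N].
    move=> k'N; rewrite addnS => /(contraR (@col_b _ _)) /YP[i' i'g].
    have ch := c_lt_h h1 i'g; case=> E.
      have cj : j.+1 = c i' by apply: (eqmod_near _ _ (colE E)); lia.
      have i's : i' = s.+1 by have := @cK i'; rewrite -cj /s; lia.
      by move: E; rewrite -cj i's => /colE2.
    have cj : j = c i' by apply/eq_add_S/(eqmod_near _ _ (colE E)); lia.
    have i's : i' = s by have := @cK i'; rewrite -cj /s; lia.
    by move: E; rewrite -cj i's => /colE2/eqmod_near; lia.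
  move=> /(cut _ k1N) E1 /(cut _ k2N) E2.
  by apply/(@addnI s.+1)/(@eqmod_near N); [lia | lia | rewrite E1 E2].
- move=> H; apply: to_hub_above H _; apply: to_hub_below (hs s.+1).
  by apply/connect1/col_a; rewrite -cs X_inS.
- move=> H; apply: to_hub_above H _; apply: to_hub_below (hs s).
  by apply/connect1/col_a; rewrite -cs X_in.
Qed.

Lemma col_connected x y : connect col_colour x y.
Proof.
suff hubP z : connect col_colour hub z.
  by apply: connect_trans (hubP y); rewrite hub_sym.
case: (eqVneq h 1) => h1; first exact: one_column.
by have [i [j [jh ->]]] := col_surj z; apply: later_columns.
Qed.

End TwoColouring.

(** * Circulants with one or two distances *)

Definition circ1 (m : nat) (A : 'Z_m) : rel 'Z_m :=
  fun x y => (y == x + A)%R || (x == y + A)%R.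

Definition circ2 (m : nat) (A B : 'Z_m) : rel 'Z_m :=
  fun x y => circ1 A x y || circ1 B x y.

Lemma circ2C m (A B : 'Z_m) : circ2 A B =2 circ2 B A.
Proof. by move=> x y; rewrite /circ2 orbC. Qed.

Lemma circ1N m (A : 'Z_m) : circ1 (- A)%R =2 circ1 A.
Proof.
by move=> x y; rewrite /circ1 orbC (eq_sym y) (eq_sym x (y - A)%R) !subr_eq orbC.
Qed.

Lemma circ1_disjoint m (A B : 'Z_m) x y : A != B -> A != (- B)%R ->
  circ1 A x y -> ~~ circ1 B x y.
Proof.
move=> AB ANB; rewrite /circ1 => xyA; apply/negP=> xyB.
have yE C : (y == x + C)%R || (x == y + C)%R -> (y - x = C \/ y - x = - C)%R.
  by case/orP=> /eqP->; [left|right]; ring.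
case: (yE _ xyA) (yE _ xyB) => -> [] /eqP; rewrite ?eqr_opp ?(negbTE AB) //.
  by rewrite (negbTE ANB).
by rewrite eqr_oppLR (negbTE ANB).
Qed.

Lemma circ1_ham m a : 1 < m -> coprime a m ->
  ham_decomposition (circ1 (a%:R : 'Z_m)%R).
Proof.
move=> m1 co; have Au : (a%:R : 'Z_m)%R \is a GRing.unit by rewrite unitZpE // coprime_sym.
set A := (a%:R : 'Z_m)%R in Au *.
exists unit, (fun _ i => i * A)%R; split.
- by move=> _ i j; apply: mulIr.
- move=> _ x y [i [] [-> ->]]; rewrite /circ1 mulrDl mul1r eqxx ?orbT //.
- move=> x y xy; exists tt; case/orP: xy => /eqP->.
    by exists (x / A)%R; left; rewrite mulrDl mul1r divrK.
  by exists (y / A)%R; right; rewrite mulrDl mul1r divrK.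
- by case=> [] [].
Qed.

(** * Choice of the parallelograms for given a and b *)

Section SwapColouring.

Variables m a b : nat.
Hypotheses (m_gt1 : 1 < m) (m_odd : odd m) (a_bnd : 0 < a < m).
Hypothesis co : coprime (gcdn a m) (gcdn b m).
Hypothesis hg : gcdn b m < gcdn a m.
Hypothesis turn : gcdn b m = 1 -> exists2 n, 2 * n < m & n * b = a %[mod m].

Let g := gcdn a m.
Let h := gcdn b m.
Let r := m %/ g.
Let N := m %/ h.
(** For h = 1 all g - 1 parallelograms alternate. Otherwise the last h - 3 are kept to attach
    columns 3, ..., h - 1. *)
Let K := if h == 1 then g.-1 else g - h + 2.
Let c i : nat := if i < K then nat_of_bool (odd i) else i - K + 2.

(** What remains is arithmetic on g, h, K and c. For h = 1 the b-edges form one cycle, on which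
    adding a amounts to n steps, so column j starts at place j n. *)
Lemma swap_colouring : exists T : pred 'Z_m,
  [/\ forall x, T x -> ~~ T (x + a%:R)%R, forall x, T x -> ~~ T (x + b%:R)%R,
      forall x y, connect (colour a%:R b%:R (sides T b%:R) (sides T a%:R))%R x y &
      forall x y, connect (colour b%:R a%:R (sides T a%:R) (sides T b%:R))%R x y].
Proof.
have co' : coprime h g by rewrite coprime_sym.
have g_dvd : g %| m by apply: dvdn_gcdr.
have h_dvd : h %| m by apply: dvdn_gcdr.
have gr : m = r * g by rewrite divnK.
have hN : m = N * h by rewrite divnK.
have odd_g : odd g by move: m_odd; rewrite gr oddM => /andP[].
have odd_r : odd r by move: m_odd; rewrite gr oddM => /andP[].
have odd_h : odd h by move: m_odd; rewrite hN oddM => /andP[].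
have h_gt0 : 0 < h by case: (h) odd_h.
have g_gt0 : 0 < g by case: (g) odd_g.
have g_lt_m : g < m.
  case/andP: a_bnd => a0; apply: leq_ltn_trans.
  by apply: dvdn_leq => //; apply: dvdn_gcdl.
have r_ge3 : 2 < r.
  have : r != 1 by apply/eqP=> r1; move: g_lt_m; rewrite [X in _ < X]gr r1 mul1n ltnn.
  by move: odd_r; case: (r) => [|[|[|]]].
have r_gt0 : 0 < r by apply: leq_trans r_ge3.
have N_gt0 : 0 < N by move: hN m_gt1; case: (N) => // ->.
(* h divides m = r g and is coprime to g, hence divides r; likewise g divides N. *)
have hr : h <= r by apply: dvdn_leq => //; rewrite -(Gauss_dvdl _ co') -gr.
have gN : g <= N by apply: dvdn_leq => //; rewrite -(Gauss_dvdl _ co) -hN.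
pose vtx := grid m a b.
have rowE i j i' j' : vtx i j = vtx i' j' -> i = i' %[mod g] by apply: grid_row.
have rowE2 i j j' : vtx i j = vtx i j' -> j = j' %[mod r] by apply: grid_row_eq.
have colE i j i' j' : vtx i j = vtx i' j' -> j = j' %[mod h].
  by rewrite /vtx !(gridC m a b); apply: grid_row.
have colE2 i i' j : vtx i j = vtx i' j -> i = i' %[mod N].
  by rewrite /vtx !(gridC m a b); apply: grid_row_eq.
have row_from s i j : exists2 k, k < r & vtx i j = vtx i (s + k) by apply: grid_from.
have col_from s i j : exists2 k, k < N & vtx i j = vtx (s + k) j.
  have [k kN E] := grid_from b a m_gt1 s j i.
  by exists k; rewrite // /vtx !(gridC m a b).
have row_wrap i j : vtx i (j + r) = vtx i j by rewrite -[in r](mul1n r) /vtx grid_period.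
have col_wrap i j : vtx (i + N) j = vtx i j.
  by rewrite /vtx !(gridC m a b) -[in N](mul1n N) grid_period.
have row_surj v : exists i j, i < g /\ v = vtx i j.
  by have [i [j [ig _ ->]]] := grid_surj m_gt1 co v; exists i, j.
have col_surj v : exists i j, j < h /\ v = vtx i j.
  have [j [i [jh _ ->]]] := grid_surj m_gt1 co' v.
  by exists i, j; rewrite /vtx gridC.
have h_ge3 : h != 1 -> 3 <= h by move: odd_h; case: (h) => [|[|[|]]].
have hg' : h < g by [].
have K_h : h != 1 -> K = g - h + 2 by rewrite /K => /negbTE->.
have K_1 : h = 1 -> K = g.-1 by rewrite /K => ->.
have turn' : h = 1 -> exists n, [/\ K.+1 = g, g <= n, 2 * n + g <= m, N = m &
    forall i j, vtx i j = vtx (i + j * n) 0].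
  move=> h1; have [n nm E] := turn h1.
  have gb : coprime g b.
    rewrite /coprime -dvdn1 -h1 dvdn_gcd dvdn_gcdr.
    by rewrite (dvdn_trans _ g_dvd) // dvdn_gcdl.
  (* g divides a, which is n b modulo m, and is coprime to b. *)
  have gn : g %| n.
    rewrite -(Gauss_dvdl _ gb) /dvdn; have := congr1 (modn^~ g) E.
    by rewrite !modn_dvdm // => ->; apply: dvdn_gcdl.
  have n0 : 0 < n.
    rewrite lt0n; apply/eqP=> n0; move: E; rewrite n0 mul0n mod0n modn_small; lia.
  exists n; split.
  - by rewrite K_1 // prednK.
  - exact: dvdn_leq.
  (* m - 2 n is a positive multiple of g. *)
  - rewrite -leq_subRL; last exact: ltnW.
    by apply: dvdn_leq; [rewrite subn_gt0 | apply: dvdn_sub (dvdn_mull 2 gn)].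
  - by rewrite /N h1 divn1.
  - move=> i j; apply/eqP; rewrite eq_Zp_nat // mul0n addn0 mulnDl eqn_modDl.
    by rewrite -mulnA -modnMmr -E modnMmr.
have {odd_g odd_h gr hN g_dvd h_dvd co' odd_r} arith :
    [/\ ~~ odd K, 2 <= K & K < g].
  have K_even : ~~ odd K.
    rewrite /K; case: eqP => _; first by case: (g) odd_g => //= g' /negbTE->.
    by rewrite addn2 /= negbK oddB ?odd_g ?odd_h // ltnW.
  clear -K_even h_ge3 hg' K_h K_1 odd_g odd_h h_gt0.
  case: (eqVneq h 1) => h1.
    by have KE := K_1 h1; split=> //; lia.
  by have KE := K_h h1; have h3 := h_ge3 h1; split=> //; lia.
case: arith => K_even K_ge2 K_lt.
have c_small i : i < K -> c i = odd i by rewrite /c => ->.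
have c_big i : K <= i -> c i = i - K + 2 by rewrite /c ltnNge => ->.
have c_lt i : i < g.-1 -> c i + 2 <= maxn 3 h.
  clear -K_1 K_h h_ge3 hg' K_lt c_small c_big => ig.
  case: (ltnP i K) => iK; first by rewrite c_small //; case: (odd i); lia.
  case: (eqVneq h 1) => h1; first by move: iK; rewrite K_1 //; lia.
  by rewrite c_big //; move: iK; rewrite K_h //; have := h_ge3 h1; lia.
have c_lt_r i : i < g.-1 -> c i + 2 <= r.
  by clear -c_lt hr r_ge3 => /c_lt; lia.
have c_lt_h i : h != 1 -> i < g.-1 -> c i + 2 <= h.
  by clear -c_lt h_ge3 => /h_ge3 h3 /c_lt; lia.
exists (@squares m a b g c); split.
- by exact: (@squares_a m a b g h r N K c).
- by exact: (@squares_b m a b g h r N K c).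
- by exact: (@row_connected m a b g h r N K c).
- by exact: (@col_connected m a b g h r N K c).
Qed.

End SwapColouring.

Lemma circ2_colour m (A B : 'Z_m) X Y x y :
  colour A B X Y x y || colour B A Y X x y = circ2 A B x y.
Proof.
rewrite /colour /step /circ2 /circ1.
by case: (y == x + A)%R (y == x + B)%R (x == y + A)%R (x == y + B)%R
  (X x) (Y x) (X y) (Y y) => [] [] [] [] [] [] [] [].
Qed.

Lemma colour_disjoint m (A B : 'Z_m) X Y x y :
  (A != - A)%R -> (B != - B)%R -> A != B -> (A != - B)%R ->
  colour A B X Y x y -> ~~ colour B A Y X x y.
Proof.
move=> AA BB AB ANB.
have self C : (C != - C)%R -> ~~ ((y == x + C)%R && (x == y + C)%R).
  move=> CC; apply/negP=> /andP[/eqP->]; rewrite -addrA -[X in X == _]addr0.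
  by rewrite (inj_eq (addrI x)) eq_sym addr_eq0 (negbTE CC).
have dis : ~~ (circ1 A x y && circ1 B x y).
  by apply/negP=> /andP[xyA xyB]; have := circ1_disjoint AB ANB xyA; rewrite xyB.
move: (self _ AA) (self _ BB) dis; rewrite /colour /step /circ1.
by case: (y == x + A)%R (y == x + B)%R (x == y + A)%R (x == y + B)%R
  (X x) (Y x) (X y) (Y y) => [] [] [] [] [] [] [] [].
Qed.

Lemma Zp_natN m x : 1 < m -> x <= m -> ((m - x)%:R = - x%:R :> 'Z_m)%R.
Proof. by move=> m1 xm; rewrite natrB // pchar_Zp // sub0r. Qed.

Lemma Zp_nat_neqN m x y : 1 < m -> 0 < x < m -> 0 < y < m -> x + y != m ->
  ((x%:R : 'Z_m) != - y%:R)%R.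
Proof.
move=> m1 xm ym xy; rewrite -Zp_natN //; last by lia.
by rewrite eq_Zp_nat // !modn_small; lia.
Qed.

Lemma Zp_nat_neq m x y : 1 < m -> 0 < x < m -> 0 < y < m -> x != y ->
  ((x%:R : 'Z_m) != y%:R)%R.
Proof. by move=> m1 xm ym xy; rewrite eq_Zp_nat // !modn_small; lia. Qed.

Section Circulant.

Variables m a b : nat.
Hypotheses (m_gt2 : 2 < m) (m_odd : odd m).
Hypotheses (a_bnd : 0 < a < m) (b_bnd : 0 < b < m).
Hypotheses (ab : a != b) (ab_m : a + b != m) (co : coprime (gcdn a m) (gcdn b m)).

Let m_gt1 : 1 < m. Proof. exact: ltnW. Qed.

Lemma circ2_ham_turn : gcdn b m < gcdn a m ->
  (gcdn b m = 1 -> exists2 n, 2 * n < m & n * b = a %[mod m]) ->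
  ham_decomposition (circ2 (a%:R : 'Z_m) (b%:R : 'Z_m))%R.
Proof.
move=> hg turn.
have [T [Ta Tb rowc colc]] := swap_colouring m_gt1 m_odd a_bnd co hg turn.
set A := (a%:R : 'Z_m)%R in Ta rowc colc *; set B := (b%:R : 'Z_m)%R in Tb rowc colc *.
have AA : (A != - A)%R by apply: Zp_nat_neqN; lia.
have BB : (B != - B)%R by apply: Zp_nat_neqN; lia.
have AB : A != B by apply: Zp_nat_neq.
have ANB : (A != - B)%R by apply: Zp_nat_neqN.
have BA : B != A by rewrite eq_sym.
have BNA : (B != - A)%R by rewrite -eqr_oppLR eq_sym.
have nz (C : 'Z_m) : (C != - C)%R -> C != 0%R by apply: contra => /eqP->; rewrite oppr0.
have [p p_inj pE] := ham_of_connected m_gt2 (@colour_sym _ A B _ _)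
  (colour_irr _ _ (nz _ AA) (nz _ BB)) (colour_regular AA BB AB ANB Ta Tb) rowc.
have [q q_inj qE] := ham_of_connected m_gt2 (@colour_sym _ B A _ _)
  (colour_irr _ _ (nz _ BB) (nz _ AA)) (colour_regular BB AA BA BNA Tb Ta) colc.
exists bool, (fun k => if k then p else q); split.
- by case.
- case=> x y e; rewrite -(circ2_colour A B (sides T B) (sides T A)).
    by have /pE-> := e.
  by have /qE-> := e; rewrite orbT.
- move=> x y; rewrite -(circ2_colour A B (sides T B) (sides T A)).
  by case/orP=> [/pE|/qE] ?; [exists true | exists false].
- have dis x y : cycle_edge p x y -> cycle_edge q x y -> False.
    by move=> /pE px /qE qx; have := colour_disjoint AA BB AB ANB px; rewrite qx.
  by case=> [] [] x y // e1 e2; case: (dis x y).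
Qed.

End Circulant.

Lemma gcdn_subl m a : a <= m -> gcdn (m - a) m = gcdn a m.
Proof. by move=> am; rewrite -{2}(subnK am) gcdnDl gcdnC -[in RHS](subnK am) gcdnDr. Qed.

(** If b is a unit, let n = a / b. Replacing a by -a preserves the graph and turns n into m - n; as
    m is odd, one of the two is below m / 2. *)
Lemma circ2_ham_lt m a b : 2 < m -> odd m -> 0 < a < m -> 0 < b < m ->
  a != b -> a + b != m -> coprime (gcdn a m) (gcdn b m) ->
  gcdn b m < gcdn a m -> ham_decomposition (circ2 (a%:R : 'Z_m) (b%:R : 'Z_m))%R.
Proof.
move=> m2 m_odd am bm ab ab_m co hg; have m1 := ltnW m2.
have [h1|h1] := eqVneq (gcdn b m) 1; last first.
  by apply: circ2_ham_turn => // E; rewrite E eqxx in h1.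
have Bu : (b%:R : 'Z_m)%R \is a GRing.unit by rewrite unitZpE // coprime_sym /coprime h1.
pose n : nat := ((a%:R : 'Z_m) / b%:R)%R.
have nm : n < m by rewrite -[m in _ < m]Zp_cast // ltn_ord.
have nb : (n%:R * b%:R = a%:R :> 'Z_m)%R by rewrite natr_Zp divrK.
case: (ltnP (2 * n) m) => n2.
  apply: circ2_ham_turn => // _; exists n => //.
  by apply/eqP; rewrite -eq_Zp_nat // natrM nb.
apply: (@ham_decomposition_ext _ (circ2 ((m - a)%:R : 'Z_m) (b%:R : 'Z_m))%R).
  move=> x y; rewrite /circ2 Zp_natN ?circ1N //; lia.
have ga : gcdn (m - a) m = gcdn a m by apply: gcdn_subl; lia.
apply: circ2_ham_turn; rewrite ?ga //; try lia.
move=> _; exists (m - n); first by lia.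
apply/eqP; rewrite -eq_Zp_nat // natrM !Zp_natN //; try lia.
by rewrite mulNr nb.
Qed.

(** Equal gcds are both 1 by coprimality, and then the a-edges and the b-edges are already
    Hamiltonian cycles. Otherwise order the pair by gcd. *)
Lemma circ2_ham m a b : 2 < m -> odd m -> 0 < a < m -> 0 < b < m ->
  a != b -> a + b != m -> coprime (gcdn a m) (gcdn b m) ->
  ham_decomposition (circ2 (a%:R : 'Z_m) (b%:R : 'Z_m))%R.
Proof.
move=> m2 m_odd am bm ab ab_m co; have m1 := ltnW m2.
case: (ltngtP (gcdn a m) (gcdn b m)) => gh; last first.
- have ca : gcdn a m = 1 by apply/eqP; move: co; rewrite /coprime -gh gcdnn.
  apply: ham_decompositionU; last 2 first.
  - by apply: circ1_ham; rewrite // /coprime ca.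
  - by apply: circ1_ham; rewrite // /coprime -gh ca.
  move=> x y; apply: circ1_disjoint; first exact: Zp_nat_neq.
  exact: Zp_nat_neqN.
- exact: circ2_ham_lt.
apply: ham_decomposition_ext (circ2C _ _) _.
by apply: circ2_ham_lt => //; [rewrite eq_sym | rewrite addnC | rewrite coprime_sym].
Qed.

(** * The circulant of the distances 3 and above *)

Definition dist (m : nat) (x y : 'Z_m) : nat := minn (x - y)%R (y - x)%R.

Lemma circ1_subE m (A x y : 'Z_m) : circ1 A x y = (x - y == - A)%R || (x - y == A)%R.
Proof.
rewrite /circ1 (subr_eq x A y) (addrC A y); congr (_ || _).
by rewrite -(opprB y x) eqr_opp subr_eq addrC.
Qed.

Section Dist.

Variable m : nat.
Hypotheses (m_gt2 : 2 < m) (m_odd : odd m).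

Let m_gt1 : 1 < m. Proof. exact: ltnW. Qed.

Lemma Zp_oppE (z : 'Z_m) : (- z)%R = (m - z) %% m :> nat.
Proof.
have zm : z < m by rewrite -[m in _ < m]Zp_cast // ltn_ord.
by rewrite -{1}[z]natr_Zp -Zp_natN ?(ltnW zm) // val_Zp_nat.
Qed.

Lemma dist_le (x y : 'Z_m) : (dist x y).*2 < m.
Proof.
rewrite /dist -(opprB x y) Zp_oppE.
have zm : (x - y)%R < m by rewrite -[m in _ < m]Zp_cast // ltn_ord.
move: ((x - y)%R : nat) zm => z zm.
case: (posnP z) => [->|z0]; first by rewrite min0n; lia.
by rewrite modn_small; lia.
Qed.

Lemma dist_circ1 d (x y : 'Z_m) : 0 < d -> d.*2 < m -> (dist x y == d) = circ1 (d%:R : 'Z_m)%R x y.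
Proof.
move=> d0 dm; rewrite circ1_subE /dist -(opprB x y).
have zm : (x - y)%R < m by rewrite -[m in _ < m]Zp_cast // ltn_ord.
rewrite -Zp_natN -?(inj_eq (@ord_inj _)) ?Zp_oppE ?val_Zp_nat //; last by lia.
move: ((x - y)%R : nat) zm => z zm.
rewrite (modn_small (m := d)) ?(modn_small (m := m - d)); try lia.
by case: (posnP z) => [->|z0]; [rewrite subn0 modnn | rewrite modn_small]; lia.
Qed.

Lemma dist0 (x y : 'Z_m) : (dist x y == 0) = (x == y).
Proof.
rewrite -[RHS]subr_eq0 /dist -(opprB x y) -(inj_eq (@ord_inj _)) Zp_oppE.
have zm : (x - y)%R < m by rewrite -[m in _ < m]Zp_cast // ltn_ord.
move: ((x - y)%R : nat) zm => z zm.
by case: (posnP z) => [->|z0]; [rewrite subn0 modnn | rewrite modn_small]; lia.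
Qed.

(** Each step adds the pair 3 + 2k, 4 + 2k; consecutive integers are coprime, and so are their gcds
    with m. *)
Lemma dist_pairs_ham k : k.*2.+2 <= m./2 ->
  ham_decomposition (fun x y : 'Z_m => 3 <= dist x y < 3 + k.*2).
Proof.
elim: k => [|k IH] km.
  exists void, (fun _ => id); split=> //; try by case.
  by move=> x y /andP[]; lia.
pose d := 3 + k.*2.
have dm : 0 < d < m by rewrite /d; lia.
have dm' : 0 < d.+1 < m by rewrite /d; lia.
have co : coprime (gcdn d m) (gcdn d.+1 m).
  apply: (coprime_dvdl (dvdn_gcdl _ _)); apply: (coprime_dvdr (dvdn_gcdl _ _)).
  exact: coprimenS.
have H : ham_decomposition (circ2 (d%:R : 'Z_m) (d.+1%:R : 'Z_m))%R.
  by apply: circ2_ham => //; rewrite /d; lia.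
have E x y : circ2 (d%:R : 'Z_m)%R (d.+1%:R : 'Z_m)%R x y = (d <= dist x y < d.+2).
  by rewrite /circ2 -!dist_circ1 /d; lia.
apply: ham_decomposition_ext (ham_decompositionU _ (IH _) H).
- by move=> x y /=; rewrite E /d; lia.
- by move=> x y; rewrite E /d; lia.
- by lia.
Qed.

Lemma dist_ham : 7 <= m -> ham_decomposition (fun x y : 'Z_m => 3 <= dist x y).
Proof.
(* k pairs can be formed from the distances 3, ..., [m./2]; one is left over when [m./2] is odd. *)
move=> m7; pose k := (m./2 - 2)./2.
have H : ham_decomposition (fun x y : 'Z_m => 3 <= dist x y < 3 + k.*2).
  by apply: dist_pairs_ham => //; rewrite /k; lia.
case: (boolP (odd m./2)) => n_odd; last first.
  apply: ham_decomposition_ext H => x y; have := dist_le x y.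
  by rewrite /k; lia.
have co : coprime m./2 m.
  (* m is [m./2] plus its successor. *)
  rewrite -[X in coprime _ X](odd_double_half m) m_odd add1n -addnn -addSn.
  by rewrite coprime_sym /coprime gcdnC gcdnDr; apply: coprimenS.
apply: ham_decomposition_ext (ham_decompositionU _ H (circ1_ham m_gt1 co)).
  by move=> x y /=; rewrite -dist_circ1; have := dist_le x y; rewrite /k; lia.
by move=> x y; rewrite -dist_circ1 /k; lia.
Qed.

(** This form shows the complement of W as the graph of the distances at least 3; the edge inside a
    column has distance 0. *)
Lemma W_dist (u v : 'Z_m * bool) : 4 < m -> W u v = (u != v) && (dist u.1 v.1 < 3).
Proof.
case: u v => [x a] [y b] m4; rewrite /W /lexprod /Circ /complete /= !inE xpair_eqE.
have [->|xy] := eqVneq x y.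
  have := dist0 y y; rewrite eqxx => /eqP->; rewrite subrr !(eq_sym 0%R) !oppr_eq0.
  have E k : 0 < k < m -> ((k%:R : 'Z_m) == 0)%R = false.
    by move=> km; rewrite -[0%R]/(0%:R)%R eq_Zp_nat // mod0n modn_small; lia.
  by rewrite (E 1) ?(E 2) ?andbT //=; lia.
have := dist0 x y; rewrite (negbTE xy) /= orbF => d0.
have -> : dist x y < 3 = (dist x y == 1) || (dist x y == 2) by move: d0; lia.
rewrite !dist_circ1 //; try lia.
rewrite !circ1_subE.
by do 4![case: (_ == _)%R => //=].
Qed.

End Dist.

(** * From W^* to K_2m^* *)

Lemma card_bijection (T T' : finType) : #|T| = #|T'| ->
  exists f : T -> T', bijective f.
Proof.
move=> E; exists (fun x => enum_val (cast_ord E (enum_rank x))).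
apply: inj_card_bij; last by rewrite E.
by move=> x y /enum_val_inj/cast_ord_inj/enum_rank_inj.
Qed.

Theorem theorem3p5 (m : nat) (m_ge7 : 7 <= m) (m_odd : odd m)
    (ms : seq nat) (ms_ge2 : all (fun k => 2 <= k) ms)
    (ms_order : sumn ms = 2 * m)
    (ms_bipartite : all (fun k => ~~ odd k) ms) :
  has_factorization (two_factor ms) (symdigraph (@W m)) ->
  has_factorization (two_factor ms) (symdigraph (@complete 'I_(2 * m))).
Proof.
have m_gt4 : 4 < m by apply: leq_trans m_ge7.
have m_gt2 : 2 < m by apply: leq_trans m_ge7.
have m_gt1 : 1 < m by apply: leq_trans m_ge7.
have F0 : two_factor ms != set0.
  have /card_gt0P[u _] : 0 < #|two_factor_vertex ms|.
    by rewrite card_two_factor_vertex ms_order muln_gt0 /= ltnW.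
  have [v uv] := two_factor_succ m_gt1 ms_ge2 ms_bipartite ms_order u.
  by apply/set0Pn; exists (u, v).
rewrite !factor_familyP // => famW.
have famD := factor_family_lexprod m_gt2 m_odd ms_ge2 ms_bipartite ms_order
  (dist_ham m_gt2 m_odd m_ge7).
have [f f_bij] : exists f : 'I_(2 * m) -> 'Z_m * bool, bijective f.
  by apply: card_bijection; rewrite card_prod card_bool card_Z // card_ord mulnC.
(* Pull back to ['I_(2 * m)] the disjoint union of the arcs of distance at most 2 and those of
   distance at least 3. *)
apply: (factor_family_transport f_bij _ (factor_familyU _ famW famD)); last first.
  rewrite -setI_eq0; apply/eqP/setP=> -[u v]; rewrite !inE /= W_dist //.
  by rewrite ltnNge -andbA andNb andbF.
move=> u v; rewrite !inE /= W_dist // /complete -(bij_eq f_bij).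
have [->|_] := eqVneq (f u) (f v); last by rewrite /= ltnNge orNb.
by have := dist0 m_gt2 m_odd (f v).1 (f v).1; rewrite eqxx => /eqP->.
Qed.
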